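(* Let $P=(P_{ij})_{i,j\in E}$ be an irreducible aperiodic transition matrix on a countable state space $E$ and let $H$ be a non-empty finite subset of $E$. Then the chain is non-strongly ergodic if and only if there is a sequence $\{y^{(n)}\}_{n=1}^{\infty}$ of real-valued functions $y^{(n)}=(y^{(n)}_i)_{i\notin H}$ on $E\setminus H$ satisfying the following conditions: (1) for each $n\ge 1$, $\sup_{i\notin H} y^{(n)}_i<\infty$ and $y=y^{(n)}$ solves the inequality $$y_i\le \sum_{j\notin H}P_{ij}\,y_j+1,\qquad i\notin H;$$ (2) $\sup_{n\ge 1}\sup_{i\notin H} y^{(n)}_i=\infty$ (or equivalently, $\varlimsup_{n\to\infty}\sup_{i\notin H}y^{(n)}_i=\infty$).
   Context: $P$ is a stochastic matrix and $(X_n)_{n\ge0}$ the associated discrete-time Markov chain. The chain is strongly ergodic if, with $\pi$ its stationary probability distribution, $\lim_{n\to\infty}\sup_{i\in E}\sum_{j\in E}|(P^n)_{ij}-\pi_j|=0$. Known equivalent description: with $\sigma_H=\inf\{n\ge1: X_n\in H\}$, the chain is strongly ergodic iff $(\mathbf{E}_i\sigma_H)_{i\notin H}$ is bounded for some (equivalently, any) non-empty finite $H\subseteq E$. The functions $y^{(n)}$ are finite-valued but need not be non-negative nor bounded below. *)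

(* Defs.v *)
From HB Require Import structures.
From mathcomp Require Import all_boot all_order all_algebra.
From mathcomp Require Import all_classical all_reals all_analysis.

Set Implicit Arguments.
Unset Strict Implicit.
Unset Printing Implicit Defensive.

Import Order.TTheory GRing.Theory Num.Theory.
Import numFieldNormedType.Exports.

Local Open Scope classical_set_scope.
Local Open Scope ring_scope.
Local Open Scope ereal_scope.

Section MarkovChain.
Context {R : realType} {E : countType}.
Implicit Types (P : E -> E -> R) (mu : E -> R).

Definition prob_vector mu :=
  (forall j, (0 <= mu j)%R) /\ \esum_(j in [set: E]) (mu j)%:E = 1.

Definition stochastic P := forall i, prob_vector (P i).

(* Entries of P^n. They are kept in \bar R so that no truncation is needed
   to read off the value of the sum; they lie in [0, 1] when P is stochastic. *)
Fixpoint power P (n : nat) (i j : E) : \bar R :=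
  if n is m.+1 then \esum_(k in [set: E]) ((P i k)%:E * power P m k j)
  else ((i == j)%:R)%:E.

Definition irreducible P := forall i j, exists n, 0 < power P n i j.

(* gcd {n >= 1 | (P^n)_ii > 0} = 1 for every i. *)
Definition aperiodic P := forall (i : E) (d : nat),
  (forall n, (1 <= n)%N -> 0 < power P n i i -> (d %| n)%N) -> d = 1%N.

Definition stationary P mu := prob_vector mu /\
  forall j, \esum_(i in [set: E]) (mu i * P i j)%:E = (mu j)%:E.

Definition strongly_ergodic P := exists mu, stationary P mu /\
  (fun n => ereal_sup [set \esum_(j in [set: E]) `|power P n i j - (mu j)%:E|
                      | i in [set: E]]) @ \oo --> 0.

(* \esum is only meaningful for nonnegative terms, so a signed sum is the
   difference of the sums of the positive and the negative parts. It is
   well-defined in [-oo, +oo[ as soon as the former is finite. *)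
Definition signed_sum (D : set E) (f : E -> R) : \bar R :=
  \esum_(j in D) (Num.max (f j) 0)%:E - \esum_(j in D) (Num.max (- f j)%R 0)%:E.

Definition sup_off (H : set E) (y : E -> R) : \bar R :=
  ereal_sup [set (y i)%:E | i in ~` H].

(* Only the values of y off H are constrained or used. If y is unbounded below
   and the sum is -oo then the inequality fails, y i being real. *)
Definition subsolution P (H : set E) (y : E -> R) := forall i, ~ H i ->
  (y i)%:E <= signed_sum (~` H) (fun j => P i j * y j)%R + 1.

Definition bounded_above_subsolutions P (H : set E) (y : nat -> E -> R) :=
  forall n, (1 <= n)%N -> sup_off H (y n) < +oo /\ subsolution P H (y n).

End MarkovChain.

(* Main.v *)
Require Import Defs.
From HB Require Import structures.
From mathcomp Require Import all_boot all_order all_algebra.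
From mathcomp Require Import all_classical all_reals all_analysis.
From mathcomp Require Import ring lra.

Set Implicit Arguments.
Unset Strict Implicit.
Unset Printing Implicit Defensive.

Import Order.TTheory GRing.Theory Num.Theory.
Import numFieldNormedType.Exports.

Local Open Scope classical_set_scope.
Local Open Scope ring_scope.
Local Open Scope ereal_scope.

(** If the chain is strongly ergodic with stationary law [pi], then for a state
    [h] of [H] and a suitable [N], [P^N i h >= d := pi h / 2] for every [i].
    Extend the positive part of a subsolution by 0 to [H]: this gives
    [z <= P z + 1] everywhere, hence [z <= P^N z + N], and as [z h = 0] the
    supremum [s] of [z] satisfies [s <= (1 - d) s + N]. So [s <= N / d], a bound
    independent of the subsolution.

    Conversely, take the truncated means [y^(n)_i = E_i min(sigma_H, n)]. If they
    were bounded by [M], Markov's inequality would give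
    [P_i(sigma_H > K) <= M / K <= 1/2] for a large [K]; by irreducibility,
    aperiodicity and finiteness of [H], a fixed state [h] would then be charged by
    some [P^N i] uniformly in [i] (Doeblin's condition), which makes [P^N] a
    contraction in l1 and the chain strongly ergodic. *)

(** * Additive sets of natural numbers with gcd 1 *)

(** The least positive difference [d] of two elements of [S] divides all of [S], so [d = 1] and [S]
    contains some [n] and [n + 1]. For [n > 0], every [m >= n * n] has quotient by [n] at least its
    remainder, hence is a combination of [n] and [n + 1]. *)
Lemma additive_gcd1_cofinite (S : set nat) :
  S 0%N -> (forall m n, S m -> S n -> S (m + n)%N) ->
  (forall d, (forall n, S n -> (d %| n)%N) -> d = 1%N) ->
  exists N, forall n, (N <= n)%N -> S n.
Proof.
move=> S0 SD Sgcd.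
have SM k n : S n -> S (k * n)%N.
  by move=> Sn; elim: k => // k ih; rewrite mulSn; exact: SD.
have [n0 n0_gt0 Sn0] : exists2 n, (0 < n)%N & S n.
  apply: contrapT => noS; suff : 2%N = 1%N by [].
  apply: Sgcd => -[//|n Sn]; exfalso; apply: noS; by exists n.+1.
pose D d := `[< (0 < d)%N /\ exists n, S n /\ S (n + d)%N >].
have exD : exists d, D d by exists n0; apply/asboolP; split => //; exists 0%N.
case: (ex_minnP exD) => d /asboolP[d_gt0 [n [Sn Snd]]] dmin.
have d1 : d = 1%N.
  apply: Sgcd => s Ss; apply: contraT => nds.
  (* The elements [s %/ d * n + s] and [s %/ d * (n + d)] of [S] differ by [s %% d]. *)
  have : (d <= s %% d)%N.
    apply: dmin; apply/asboolP; split; first by rewrite lt0n.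
    exists (s %/ d * (n + d))%N; split; first exact: SM.
    rewrite mulnDr -addnA -divn_eq; apply: SD => //; exact: SM.
  by rewrite leqNgt ltn_pmod.
subst d; have [n_eq0|n_gt0] := posnP n.
  by exists 0%N => m _; rewrite -[m]muln1; apply: SM; rewrite n_eq0 in Snd.
exists (n * n)%N => m nnm.
have rq : (m %% n <= m %/ n)%N.
  by rewrite (@leq_trans n)// ?leq_divRL// ltnW// ltn_pmod.
have -> : m = ((m %/ n - m %% n) * n + m %% n * (n + 1))%N.
  by rewrite mulnDr muln1 addnA -mulnDl subnK// -divn_eq.
by apply: SD; exact: SM.
Qed.

(** * Sums of nonnegative families *)

Section esum_extra.
Context {R : realType}.

(** The inequality [<=] is checked on finite partial sums; for [c > 0] the reverse one is the same
    inequality for [c^-1] and the family [c * a]. *)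
Lemma ge0_esumZl (T : choiceType) (D : set T) (c : R) (a : T -> \bar R) :
  (0 <= c)%R -> (forall i, D i -> 0 <= a i) ->
  \esum_(i in D) (c%:E * a i) = c%:E * \esum_(i in D) a i.
Proof.
have le_esumZ (d : R) (b : T -> \bar R) : (0 <= d)%R ->
    (forall i, D i -> 0 <= b i) ->
    \esum_(i in D) (d%:E * b i) <= d%:E * \esum_(i in D) b i.
  move=> d0 b0; apply: ge_ereal_sup => _ [X [finX XD] <-].
  rewrite fsbig_finite//= big_seq -ge0_sume_distrr; last first.
    by move=> i; rewrite in_fset_set// inE => /XD; exact: b0.
  rewrite -big_seq lee_wpmul2l ?lee_fin//.
  by apply: esum_ge; exists X => //; rewrite fsbig_finite.
move=> c0 a0; apply/eqP; rewrite eq_le le_esumZ//=.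
have [->|c_neq0] := eqVneq c 0%R.
  by rewrite mul0e esum1// => i _; rewrite mul0e.
have {c_neq0}c0 : (0 < c)%R by rewrite lt_neqAle eq_sym c_neq0.
have ca0 i : D i -> 0 <= c%:E * a i by move=> Di; rewrite mule_ge0 ?a0// lee_fin ltW.
have := @le_esumZ c^-1%R (fun i => c%:E * a i).
rewrite invr_ge0 ltW// => /(_ isT ca0).
have -> : \esum_(i in D) (c^-1%:E * (c%:E * a i)) = \esum_(i in D) a i.
  by apply: eq_esum => i _; rewrite muleA -EFinM mulVf ?gt_eqF// mul1e.
move=> /(@lee_wpmul2l _ c%:E); rewrite lee_fin ltW// => /(_ isT).
by rewrite muleA -EFinM divff ?gt_eqF// mul1e.
Qed.

Lemma ge0_esumZr (T : choiceType) (D : set T) (c : R) (a : T -> \bar R) :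
  (0 <= c)%R -> (forall i, D i -> 0 <= a i) ->
  \esum_(i in D) (a i * c%:E) = (\esum_(i in D) a i) * c%:E.
Proof.
by move=> c0 a0; rewrite muleC -ge0_esumZl//; apply: eq_esum => i _; rewrite muleC.
Qed.

Lemma exchange_esum (T1 T2 : choiceType) (a : T1 -> T2 -> \bar R) :
  (forall i j, 0 <= a i j) ->
  \esum_(i in [set: T1]) \esum_(j in [set: T2]) a i j =
  \esum_(j in [set: T2]) \esum_(i in [set: T1]) a i j.
Proof.
move=> a0; rewrite !esum_esum//.
apply: (@reindex_esum _ _ _ _ _ (fun x : T2 * T1 => (x.2, x.1))).
by split=> [//|[i j] [i' j'] _ _ [-> ->]//|[i j] _]; exists (j, i).
Qed.

Lemma esum_if_eq (T : choiceType) (h : T) (a : T -> \bar R) : 0 <= a h ->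
  \esum_(k in [set: T]) (if k == h then a k else 0) = a h.
Proof.
move=> a0; rewrite -[RHS](esum_set1 a0) [RHS]esum_mkcond.
by apply: eq_esum => k _; rewrite in_set1.
Qed.

Lemma esum_ge_term (T : choiceType) (D : set T) (a : T -> \bar R) h :
  D h -> (forall i, D i -> 0 <= a i) -> a h <= \esum_(i in D) a i.
Proof.
move=> Dh a0; apply: esum_ge; exists [set h]; last by rewrite fsbig_set1.
by split => // x ->.
Qed.

End esum_extra.

(** * The l1 distance and its completeness *)

Section l1dist.
Context {R : realType} {T : choiceType}.
Implicit Types u v w : T -> R.

(** On probability vectors this is twice the total variation distance. *)
Definition l1dist u v : \bar R := \esum_(j in [set: T]) (`|u j - v j|)%:E.

Lemma l1dist_ge0 u v : 0 <= l1dist u v.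
Proof. by apply: esum_ge0 => j _; rewrite lee_fin. Qed.

Lemma l1distC u v : l1dist u v = l1dist v u.
Proof. by apply: eq_esum => j _; rewrite distrC. Qed.

Lemma l1dist_triangle v u w : l1dist u w <= l1dist u v + l1dist v w.
Proof.
rewrite -esumD; [|by move=> *; rewrite lee_fin..].
by apply: le_esum => j _; rewrite -EFinD lee_fin ler_distD.
Qed.

Lemma l1dist_ge_term u v j : (`|u j - v j|)%:E <= l1dist u v.
Proof.
exact: (@esum_ge_term _ _ _ (fun k => (`|u k - v k|)%:E)).
Qed.

Lemma le_esum_l1dist u v : (forall j, 0 <= v j)%R ->
  \esum_(j in [set: T]) (u j)%:E <= \esum_(j in [set: T]) (v j)%:E + l1dist u v.
Proof.
move=> v0; rewrite -esumD; [|by move=> j _; rewrite lee_fin..].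
apply: le_esum => j _; rewrite -EFinD lee_fin -lerBlDl.
exact: ler_norm.
Qed.

Lemma dist_esum_le u v (a b : R) : (forall j, 0 <= u j)%R ->
  (forall j, 0 <= v j)%R -> \esum_(j in [set: T]) (u j)%:E = a%:E ->
  \esum_(j in [set: T]) (v j)%:E = b%:E -> (`|a - b|)%:E <= l1dist u v.
Proof.
move=> u0 v0 ua vb; have := le_esum_l1dist u v0; have := le_esum_l1dist v u0.
rewrite ua vb [l1dist v u]l1distC; have := l1dist_ge0 u v.
case: (l1dist u v) => [d| |]//=; last by move=> *; rewrite leey.
rewrite -!EFinD !lee_fin => _ ba ab; by rewrite ler_norml; lra.
Qed.

(** The intended case is [u - v = sum_k w_k (A_k - nu)]. Summing the pointwise bound over [j] and
    exchanging the sums leaves [sum_k w_k B]. It serves with [c = 1] for averaging and with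
    [c = 1 - d] for contraction. *)
Lemma l1dist_mix w (c B : R) u v (A : T -> T -> R) (nu : T -> R) :
  (forall k, 0 <= w k)%R -> \esum_(k in [set: T]) (w k)%:E = c%:E ->
  (0 <= B)%R -> (forall k, l1dist (A k) nu <= B%:E) ->
  (forall j, (`|u j - v j|)%:E <=
     \esum_(k in [set: T]) (w k * `|A k j - nu j|)%:E) ->
  l1dist u v <= (c * B)%:E.
Proof.
move=> w0 wc B0 AB uv.
apply: (le_trans (le_esum (fun j _ => uv j))).
rewrite exchange_esum; last by move=> *; rewrite lee_fin mulr_ge0.
apply: (@le_trans _ _ (\esum_(k in [set: T]) ((w k)%:E * B%:E))).
  apply: le_esum => k _.
  under eq_esum do rewrite EFinM.
  rewrite ge0_esumZl//; apply: lee_wpmul2l; first by rewrite lee_fin.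
  exact: AB.
by rewrite ge0_esumZr ?wc ?EFinM// => k _; rewrite lee_fin.
Qed.

(** The limit is taken coordinatewise. On a finite set of indices the Cauchy bound passes to the
    limit in one of the two ranks; the supremum over finite sets then gives the l1 bound. *)
Lemma l1dist_complete (u : nat -> T -> R) :
  (forall e : R, (0 < e)%R -> exists N, forall m n, (N <= m)%N -> (N <= n)%N ->
     l1dist (u m) (u n) <= e%:E) ->
  exists mu, forall e : R, (0 < e)%R ->
    exists N, forall n, (N <= n)%N -> l1dist (u n) mu <= e%:E.
Proof.
move=> u_cauchy.
have cvgu j : cvgn (fun n => u n j).
  apply/cauchy_cvgP/cauchy_exP => e e0.
  have [N uN] := u_cauchy (e / 2)%R (divr_gt0 e0 (ltr0n _ 2)).
  exists (u N j); exists N => // n /= Nn.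
  rewrite -ball_normE /=.
  have := le_trans (l1dist_ge_term (u N) (u n) j) (uN _ _ (leqnn N) Nn).
  by rewrite lee_fin => /le_lt_trans; apply; lra.
exists (fun j => limn (fun n => u n j)) => e /u_cauchy [N uN].
exists N => n Nn; apply: ge_ereal_sup => _ [X [finX _] <-].
rewrite fsbig_finite// sumEFin lee_fin.
have cvgS : (fun m => (\sum_(j <- finmap.enum_fset (fset_set X)) `|u n j - u m j|)%R)
    @ \oo -->
    (\sum_(j <- finmap.enum_fset (fset_set X)) `|u n j - limn (fun m => u m j)|)%R.
  elim: (finmap.enum_fset (fset_set X)) => [|j s ih].
    by under eq_fun do rewrite big_nil; rewrite big_nil; exact: cvg_cst.
  under eq_fun do rewrite big_cons; rewrite big_cons; apply: cvgD => //.
  by apply: cvg_norm; apply: cvgB; [exact: cvg_cst|exact: cvgu].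
apply: (cvgr_to_le cvgS); exists N => // m /= Nm.
rewrite -lee_fin -sumEFin; apply: le_trans (uN n m Nn Nm).
by apply: esum_ge; exists X => //; rewrite fsbig_finite.
Qed.

End l1dist.

(** * Powers of a stochastic matrix *)

Section powers.
Context {R : realType} {E : countType} (P : E -> E -> R).
Hypothesis P_stochastic : stochastic P.

(** Since [P] is stochastic the entries lie in [0, 1], so [fine] loses nothing ([powerE]). *)
Definition powerR n i j : R := fine (power P n i j).

Let P_ge0 i j : (0 <= P i j)%R.
Proof. exact: (P_stochastic i).1. Qed.

Lemma power_ge0 n i j : 0 <= power P n i j.
Proof.
elim: n i j => [|n ih] i j /=; first by rewrite lee_fin.
by apply: esum_ge0 => k _; rewrite mule_ge0 ?lee_fin.
Qed.

Lemma power_le1 n i j : power P n i j <= 1.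
Proof.
elim: n i j => [|n ih] i j /=; first by rewrite lee_fin lern1 leq_b1.
rewrite -(P_stochastic i).2; apply: le_esum => k _.
by rewrite -[leRHS]mule1; apply: lee_wpmul2l; rewrite ?lee_fin.
Qed.

Lemma powerE n i j : power P n i j = (powerR n i j)%:E.
Proof.
rewrite fineK// fin_numElt (lt_le_trans (ltNyr 0)) ?power_ge0//=.
by rewrite (le_lt_trans (power_le1 _ _ _)) ?ltry.
Qed.

Lemma powerR_ge0 n i j : (0 <= powerR n i j)%R.
Proof. by rewrite -lee_fin -powerE power_ge0. Qed.

Lemma powerR_le1 n i j : (powerR n i j <= 1)%R.
Proof. by rewrite -lee_fin -powerE power_le1. Qed.

Lemma powerR0 i j : powerR 0 i j = (i == j)%:R.
Proof. by []. Qed.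

Lemma esum_powerR0 i (f : E -> R) : (0 <= f i)%R ->
  \esum_(j in [set: E]) (powerR 0 i j * f j)%:E = (f i)%:E.
Proof.
move=> fi; under eq_esum => j _.
  rewrite powerR0 eq_sym (_ : (_ * _)%:E = if j == i then (f i)%:E else 0).
    over.
  by case: eqP => [->|_]; rewrite ?mul1r ?mul0r.
by rewrite (@esum_if_eq _ _ i (fun=> (f i)%:E)) ?lee_fin.
Qed.

Lemma powerRS n i j :
  \esum_(k in [set: E]) (P i k * powerR n k j)%:E = (powerR n.+1 i j)%:E.
Proof. by rewrite -powerE /=; apply: eq_esum => k _; rewrite EFinM powerE. Qed.

Lemma powerR1 i j : powerR 1 i j = P i j.
Proof.
apply/EFin_inj; rewrite -powerRS.
rewrite -(@esum_if_eq _ _ j (fun k => (P i k)%:E)) ?lee_fin//.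
apply: eq_esum => k _; rewrite powerR0.
by case: eqP => _; rewrite ?mulr1 ?mulr0.
Qed.

(** Tonelli's theorem: [P^(n+1) f = P (P^n f)], both sides being possibly infinite. *)
Lemma esum_powerRS n i (f : E -> R) : (forall j, 0 <= f j)%R ->
  \esum_(j in [set: E]) (powerR n.+1 i j * f j)%:E =
  \esum_(k in [set: E])
    ((P i k)%:E * \esum_(j in [set: E]) (powerR n k j * f j)%:E).
Proof.
move=> f0; under [RHS]eq_esum => k _.
  rewrite -ge0_esumZl//; last by move=> j _; rewrite lee_fin mulr_ge0 ?powerR_ge0.
  over.
rewrite exchange_esum; last first.
  by move=> k j; rewrite -EFinM lee_fin !mulr_ge0 ?powerR_ge0.
apply: eq_esum => j _; rewrite EFinM -powerRS -ge0_esumZr//; last first.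
  by move=> k _; rewrite lee_fin mulr_ge0 ?powerR_ge0.
by apply: eq_esum => k _; rewrite -!EFinM mulrA.
Qed.

Lemma powerR_stochastic n : stochastic (powerR n).
Proof.
move=> i; split; first exact: powerR_ge0.
elim: n i => [|n ih] i.
  rewrite -[RHS](@esum_powerR0 i (fun=> 1%R))//.
  by apply: eq_esum => j _; rewrite mulr1.
under eq_esum do rewrite -[powerR _ _ _]mulr1.
rewrite esum_powerRS// -(P_stochastic i).2; apply: eq_esum => k _.
by under eq_esum do rewrite mulr1; rewrite ih mule1.
Qed.

(** The Chapman-Kolmogorov equation, by induction on [m] with [f] a column of [P^n] in
    [esum_powerRS]. *)
Lemma powerRD m n i j :
  \esum_(k in [set: E]) (powerR m i k * powerR n k j)%:E =
  (powerR (m + n) i j)%:E.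
Proof.
elim: m i => [|m ih] i; first by rewrite esum_powerR0 ?powerR_ge0.
rewrite esum_powerRS; last by move=> k; exact: powerR_ge0.
rewrite addSn -powerRS; apply: eq_esum => k _; by rewrite ih EFinM.
Qed.

Lemma powerR_gt0D m n i k j :
  (0 < powerR m i k)%R -> (0 < powerR n k j)%R -> (0 < powerR (m + n) i j)%R.
Proof.
move=> mik nkj; apply: lt_le_trans (mulr_gt0 mik nkj) _.
rewrite -lee_fin -powerRD.
apply: (@esum_ge_term _ _ _ (fun k => (powerR m i k * powerR n k j)%:E)) => //.
by move=> l _; rewrite lee_fin mulr_ge0 ?powerR_ge0.
Qed.

Lemma stationary_powerR mu n j : stationary P mu ->
  \esum_(i in [set: E]) (mu i * powerR n i j)%:E = (mu j)%:E.
Proof.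
move=> [[mu0 _] muP]; elim: n j => [|n ih] j.
  rewrite -(@esum_if_eq _ _ j (fun k => (mu k)%:E)) ?lee_fin//.
  apply: eq_esum => k _; rewrite powerR0.
  by case: eqP => _; rewrite ?mulr1 ?mulr0.
under eq_esum => i _.
  rewrite EFinM -powerRS -ge0_esumZl//; last first.
    by move=> k _; rewrite lee_fin mulr_ge0 ?powerR_ge0.
  over.
rewrite exchange_esum; last first.
  by move=> i k; rewrite -EFinM lee_fin !mulr_ge0 ?powerR_ge0.
rewrite -ih; apply: eq_esum => k _; rewrite EFinM -muP -ge0_esumZr//.
- by apply: eq_esum => i _; rewrite -!EFinM mulrA.
- exact: powerR_ge0.
- by move=> i _; rewrite lee_fin mulr_ge0.
Qed.

(** Rows sum to 1, so [P] fixes constants and each iteration costs 1: [z <= P z + 1 <= P (P^n z + n)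
    + 1 = P^(n+1) z + n + 1]. *)
Lemma le_esum_powerR (z : E -> R) : (forall i, 0 <= z i)%R ->
  (forall i, (z i)%:E <= \esum_(j in [set: E]) (P i j * z j)%:E + 1) ->
  forall n i,
    (z i)%:E <= \esum_(j in [set: E]) (powerR n i j * z j)%:E + (n%:R)%:E.
Proof.
move=> z0 zP; elim=> [|n ih] i; first by rewrite esum_powerR0// adde0.
apply: le_trans (zP i) _; rewrite esum_powerRS// -natr1 EFinD addeA.
apply: leeD => //.
have -> : n%:R%:E = \esum_(k in [set: E]) ((P i k)%:E * n%:R%:E).
  by rewrite ge0_esumZr ?(P_stochastic i).2 ?mul1e// => k _; rewrite lee_fin.
have S0 k : 0 <= \esum_(j in [set: E]) (powerR n k j * z j)%:E.
  by apply: esum_ge0 => j _; rewrite lee_fin mulr_ge0 ?powerR_ge0.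
rewrite -esumD; [|by move=> k _; rewrite mule_ge0 ?lee_fin..].
apply: le_esum => k _; rewrite EFinM -ge0_muleDr ?lee_fin//.
by apply: lee_wpmul2l; rewrite ?lee_fin.
Qed.

End powers.

(** * Strong ergodicity bounds all subsolutions uniformly *)

Section ergodic_bound.
Context {R : realType} {E : countType} (P : E -> E -> R) (H : set E).
Hypothesis P_stochastic : stochastic P.

(** Irreducibility and stationarity carry some mass of [mu] to [h], so [mu h > 0]; once the uniform
    l1 distance is below [mu h / 2], every row keeps at least [mu h / 2] at [h]. *)
Lemma strongly_ergodic_minorized h : strongly_ergodic P -> irreducible P ->
  exists N (d : R), (0 < d)%R /\ forall i, (d <= powerR P N i h)%R.
Proof.
move=> [mu [mu_stat mu_lim]] P_irr.
have [[mu0 mu1] _] := mu_stat.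
have mu_h : (0 < mu h)%R.
  have [i mui] : exists i, (0 < mu i)%R.
    apply: contrapT => /forallNP mu_le0.
    have : \esum_(j in [set: E]) (mu j)%:E = 0.
      apply: esum1 => j _; congr EFin; apply/eqP; rewrite eq_le mu0 andbT leNgt.
      exact/negP.
    by rewrite mu1 => /eqP; rewrite eqe oner_eq0.
  have [n] := P_irr i h; rewrite powerE// lte_fin => pn.
  apply: lt_le_trans (mulr_gt0 mui pn) _.
  rewrite -lee_fin -(stationary_powerR P_stochastic n h mu_stat).
  apply: (@esum_ge_term _ _ _ (fun i => (mu i * powerR P n i h)%:E)) => //.
  by move=> k _; rewrite lee_fin mulr_ge0 ?powerR_ge0.
(* Convergence in [\bar R] splits into finiteness of the suprema from rank [n1] on and smallness of
   their real values from rank [n2] on. *)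
move/fine_cvgP : mu_lim => [[n1 _ fin1]] /cvgrPdist_lt.
move=> /(_ (mu h / 2)%R (divr_gt0 mu_h (ltr0n _ 2)))[n2 _ small2].
exists (maxn n1 n2), (mu h / 2)%R; split; first by rewrite divr_gt0.
move=> i; have := small2 _ (leq_maxr n1 n2); have := fin1 _ (leq_maxl n1 n2).
move: (maxn n1 n2) => N /=; set S := ereal_sup _ => Sfin Ssmall.
have : (`|powerR P N i h - mu h|)%:E <= S.
  apply: le_trans (l1dist_ge_term (powerR P N i) mu h) _.
  apply: ereal_sup_ubound; exists i => //; apply: eq_esum => j _.
  by rewrite powerE.
rewrite -(fineK Sfin) lee_fin => ph.
have Sh : (`|powerR P N i h - mu h| < mu h / 2)%R.
  apply: le_lt_trans ph _; apply: le_lt_trans Ssmall.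
  by rewrite sub0r normrN ler_norm.
move: Sh; rewrite ltr_norml => /andP[]; lra.
Qed.

(** Every row of [P^N] has mass at least [d] at [h], where [z] vanishes, so [P^N z <= r - d * r]
    with [r] the supremum of [z]. Hence [r <= r - d * r + N], and the a priori bound [s] makes [r]
    finite, so that it cancels. *)
Lemma minorized_bound (z : E -> R) h N (d s : R) : (0 < d)%R ->
  (forall i, d <= powerR P N i h)%R -> (forall i, 0 <= z i <= s)%R -> z h = 0%R ->
  (forall i, (z i)%:E <= \esum_(j in [set: E]) (P i j * z j)%:E + 1) ->
  forall i, (z i <= N%:R / d)%R.
Proof.
move=> d0 dP zs zh zP.
have z0 i : (0 <= z i)%R by have /andP[] := zs i.
set S := ereal_sup [set (z i)%:E | i in [set: E]].
have zS i : (z i)%:E <= S by apply: ereal_sup_ubound; exists i.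
have S0 : 0 <= S by apply: le_trans (zS h); rewrite lee_fin.
have Sfin : S \is a fin_num.
  rewrite fin_numElt (lt_le_trans (ltNyr 0) S0)/= (@le_lt_trans _ _ s%:E) ?ltry//.
  by apply: ge_ereal_sup => _ [i _ <-]; rewrite lee_fin; have /andP[] := zs i.
set r := fine S; have r0 : (0 <= r)%R by rewrite fine_ge0.
have zr i : (z i <= r)%R by rewrite -lee_fin fineK.
have step i : (z i <= r - d * r + N%:R)%R.
  have /= := le_esum_powerR P_stochastic z0 zP N i.
  have : \esum_(j in [set: E]) (powerR P N i j * z j)%:E + (d * r)%:E <= r%:E.
    have -> : r%:E = \esum_(j in [set: E]) ((powerR P N i j)%:E * r%:E).
      rewrite ge0_esumZr ?(powerR_stochastic P_stochastic N i).2 ?mul1e//.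
      by move=> j _; rewrite lee_fin powerR_ge0.
    apply: (@le_trans _ _ (\esum_(j in [set: E]) (powerR P N i j * z j)%:E +
        \esum_(j in [set: E]) (if j == h then (d * r)%:E else 0))).
      by rewrite (@esum_if_eq _ _ h (fun=> (d * r)%:E)) ?lee_fin ?mulr_ge0// ltW.
    rewrite -esumD; last 2 first.
    - by move=> j _; rewrite lee_fin mulr_ge0 ?powerR_ge0.
    - by move=> j _; case: ifP; rewrite ?lee_fin ?mulr_ge0// ltW.
    apply: le_esum => j _; case: eqP => [->|_].
      by rewrite zh mulr0 add0e -EFinM lee_fin ler_wpM2r.
    by rewrite adde0 -EFinM lee_fin ler_wpM2l ?powerR_ge0.
  have := @esum_ge0 _ _ [set: E] (fun j => (powerR P N i j * z j)%:E).
  move=> /(_ (fun j _ => _))H0.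
  case: (esum _ _) => [x| |]//=; rewrite -?EFinD ?lee_fin; lra.
move=> i; have : (r <= r - d * r + N%:R)%R.
  rewrite -lee_fin fineK//; apply: ge_ereal_sup => _ [j _ <-].
  by rewrite lee_fin.
move=> rN; apply: le_trans (zr i) _; rewrite ler_pdivlMr//; lra.
Qed.

Lemma signed_sum_le (D : set E) (f : E -> R) :
  signed_sum D f <= \esum_(j in D) (Num.max (f j) 0)%:E.
Proof.
rewrite -[leRHS]adde0; apply: leeD => //; rewrite oppe_le0.
by apply: esum_ge0 => j _; rewrite lee_fin le_max lexx orbT.
Qed.

(** The positive part keeps the inequality, since [P z + 1] dominates both [P y + 1] and 0;
    extending it by 0 makes the inequality hold on [H] too and gives [z h = 0]. *)
Lemma subsolution_bound (y : E -> R) h N (d : R) : H h -> (0 < d)%R ->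
  (forall i, d <= powerR P N i h)%R -> sup_off H y < +oo -> subsolution P H y ->
  sup_off H y <= (N%:R / d)%:E.
Proof.
move=> Hh d0 dP y_bnd y_sub.
pose z i := if i \in H then 0%R else Num.max (y i) 0%R.
have [s zs] : exists s : R, forall i, (0 <= z i <= s)%R.
  have [s [s0 ys]] : exists s : R, (0 <= s)%R /\ sup_off H y <= s%:E.
    case: (sup_off H y) y_bnd => [s| |]// _; last first.
      (* The value [-oo] is the supremum over the empty set, when [H] is all of [E]. *)
      by exists 0%R; rewrite lexx leNye.
    by exists (Num.max s 0%R); rewrite lee_fin !le_max !lexx orbT.
  exists s => i; rewrite /z; case: ifPn => [_|iH]; first by rewrite lexx.
  rewrite le_max lexx orbT/= ge_max s0 andbT -lee_fin; apply: le_trans ys.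
  by apply: ereal_sup_ubound; exists i => //; move: iH; rewrite notin_setE.
have zP i : (z i)%:E <= \esum_(j in [set: E]) (P i j * z j)%:E + 1.
  have S0 : 0 <= \esum_(j in [set: E]) (P i j * z j)%:E + 1.
    rewrite adde_ge0// esum_ge0// => j _; rewrite lee_fin mulr_ge0//.
      exact: (P_stochastic i).1.
    by have /andP[] := zs j.
  rewrite {1}/z; case: ifPn => // iH.
  rewrite EFin_max ge_max S0 andbT.
  have {}iH : ~ H i by move: iH; rewrite notin_setE.
  apply: le_trans (y_sub i iH) _; apply: leeD => //.
  apply: le_trans (signed_sum_le _ _) _; rewrite esum_mkcond.
  apply: le_esum => j _; rewrite in_setC /z; case: (j \in H) => /=; rewrite ?mulr0//.
  by rewrite maxr_pMr ?mulr0//; exact: (P_stochastic i).1.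
have zh : z h = 0%R by rewrite /z mem_set.
apply: ge_ereal_sup => _ [i /= iH <-]; rewrite lee_fin.
apply: le_trans (minorized_bound d0 dP zs zh zP i).
by rewrite /z ifN ?le_max ?lexx// notin_setE.
Qed.

End ergodic_bound.

(** * Probability vectors in l1 *)

Section prob_vector_l1.
Context {R : realType} {E : countType}.
Implicit Types mu nu : E -> R.

Lemma l1dist_prob_le2 mu nu : prob_vector mu -> prob_vector nu ->
  l1dist mu nu <= 2%:E.
Proof.
move=> [mu0 mu1] [nu0 nu1].
have -> : 2%:E = 1 + 1 :> \bar R by rewrite -EFinD.
rewrite -[in X in X + _]mu1 -[in X in _ + X]nu1 -esumD;
  [|by move=> j _; rewrite lee_fin..].
apply: le_esum => j _; rewrite -EFinD lee_fin.
by rewrite (le_trans (ler_normB _ _))// !ger0_norm.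
Qed.

(** Each coordinate and the total mass change by at most the l1 distance. *)
Lemma prob_vector_l1_limit mu :
  (forall e : R, (0 < e)%R -> exists2 nu, prob_vector nu & l1dist nu mu <= e%:E) ->
  prob_vector mu.
Proof.
move=> near_mu; have mu0 j : (0 <= mu j)%R.
  apply/ler_addgt0Pl => e /near_mu[nu [nu0 _] nu_e].
  have := le_trans (l1dist_ge_term nu mu j) nu_e.
  rewrite lee_fin ler_norml => /andP[_]; have := nu0 j; lra.
split=> //; apply/eqP; rewrite eq_le; apply/andP; split.
  apply/lee_addgt0Pr => e /near_mu[nu [nu0 nu1] nu_e].
  apply: le_trans (le_esum_l1dist mu nu0) _.
  by rewrite nu1 l1distC; apply: leeD.
apply/lee_addgt0Pr => e /near_mu[nu [nu0 nu1] nu_e].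
rewrite -nu1; apply: le_trans (le_esum_l1dist nu mu0) _.
by apply: leeD.
Qed.

End prob_vector_l1.

(** * Doeblin's condition implies strong ergodicity *)

Section doeblin.
Context {R : realType} {E : countType} (P : E -> E -> R).
Hypothesis P_stochastic : stochastic P.

(** Rows of [P^(r+n)] are averages of rows of [P^n], so they stay in any l1 ball containing all of
    these. This passes from the times [m * N] to all later times. *)
Lemma l1dist_powerRD_mix r n i (nu : E -> R) (B : R) : (forall j, 0 <= nu j)%R ->
  (0 <= B)%R -> (forall k, l1dist (powerR P n k) nu <= B%:E) ->
  l1dist (powerR P (r + n) i) nu <= B%:E.
Proof.
move=> nu0 B0 AB; rewrite -[B]mul1r.
apply: (l1dist_mix (powerR_ge0 P_stochastic r i)
  (powerR_stochastic P_stochastic r i).2 B0 AB) => j.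
apply: (@le_trans _ _ (l1dist (fun k => powerR P r i k * powerR P n k j)%R
                              (fun k => powerR P r i k * nu j)%R)).
  apply: dist_esum_le.
  - by move=> k; rewrite mulr_ge0 ?powerR_ge0.
  - by move=> k; rewrite mulr_ge0 ?powerR_ge0.
  - exact: powerRD.
  - under eq_esum do rewrite EFinM.
    rewrite ge0_esumZr// ?(powerR_stochastic P_stochastic r i).2 ?mul1e//.
    by move=> k _; rewrite lee_fin powerR_ge0.
apply: le_esum => k _; rewrite -mulrBr normrM lee_fin.
by rewrite ger0_norm// powerR_ge0.
Qed.

(** Row [i] of [P^N] is [d] times the unit mass at [h] plus a nonnegative [w] of mass [1 - d]. The
    first part sends every [i] to the same vector, [d] times row [h] of [P^n]; only the second
    contributes to the distance. *)
Lemma minorized_contraction h N (d : R) n (nu : E -> R) (B : R) :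
  (0 < d)%R -> (forall i, d <= powerR P N i h)%R ->
  (forall j, 0 <= nu j)%R -> (0 <= B)%R ->
  (forall k, l1dist (powerR P n k) nu <= B%:E) ->
  forall i, l1dist (powerR P (N + n) i)
    (fun j => d * powerR P n h j + (1 - d) * nu j)%R <= ((1 - d) * B)%:E.
Proof.
move=> d0 dP nu0 B0 AB i.
pose w k := (powerR P N i k - (if k == h then d else 0))%R.
have w0 k : (0 <= w k)%R.
  by rewrite /w; case: eqP => [->|_]; rewrite ?subr0 ?powerR_ge0// subr_ge0.
have d_sum : \esum_(k in [set: E]) (if k == h then d%:E else 0) = d%:E.
  by rewrite (@esum_if_eq _ _ h (fun=> d%:E))// lee_fin ltW.
have w1 : \esum_(k in [set: E]) (w k)%:E = (1 - d)%:E.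
  have : \esum_(k in [set: E]) (w k)%:E + d%:E = 1%:E.
    rewrite -{1}d_sum -esumD; last 2 first.
    - by move=> k _; rewrite lee_fin.
    - by move=> k _; case: ifP; rewrite ?lee_fin// ltW.
    rewrite -[RHS](powerR_stochastic P_stochastic N i).2; apply: eq_esum => k _.
    by rewrite /w; case: eqP => _; rewrite ?subr0 ?adde0// -EFinD subrK.
  by case: (esum _ _) => [x| |]//= [<-]; rewrite addrK.
apply: (l1dist_mix w0 w1 B0 AB) => j.
(* Summed over [k], [a] and [b] give the entries at [j] of the two vectors compared, and [a k - b k
   = w k * (powerR P n k j - nu j)]. *)
pose a k := (powerR P N i k * powerR P n k j)%R.
pose b k := (w k * nu j + (if k == h then d * powerR P n h j else 0))%R.
have if_ge0 k : (0 <= if k == h then d * powerR P n h j else 0)%R.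
  by case: ifP => // _; rewrite mulr_ge0 ?powerR_ge0// ltW.
apply: (@le_trans _ _ (l1dist a b)).
  apply: dist_esum_le.
  - by move=> k; rewrite mulr_ge0 ?powerR_ge0.
  - by move=> k; rewrite addr_ge0// mulr_ge0.
  - exact: powerRD.
  - under eq_esum do rewrite EFinD.
    rewrite esumD; last 2 first.
    - by move=> k _; rewrite lee_fin mulr_ge0.
    - by move=> k _; rewrite lee_fin.
    rewrite (addrC (d * _)%R) EFinD (EFinM (1 - d)) -w1 -ge0_esumZr//; last first.
      by move=> k _; rewrite lee_fin.
    congr (_ + _); rewrite -[RHS](@esum_if_eq _ _ h (fun=> (d * powerR P n h j)%:E)); last first.
      by rewrite lee_fin mulr_ge0 ?powerR_ge0// ltW.
    by apply: eq_esum => k _; case: ifP.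
apply: le_esum => k _; rewrite lee_fin -[X in (_ <= X * _)%R]ger0_norm//.
rewrite -normrM /a /b /w; case: eqP => [->|_]; last by rewrite !subr0 addr0 mulrBr.
by rewrite le_eqVlt; apply/orP; left; apply/eqP; congr (`| _ |)%R; ring.
Qed.

(** No stationary law is available yet, so the contraction is run with moving centres: the rows of
    [P^(m * N)] lie within [2 * (1 - d)^m] of a common [nu] depending on [m]. The limit is then that
    of row [h]. *)
Lemma minorized_l1_limit h N (d : R) : (0 < d)%R ->
  (forall i, d <= powerR P N i h)%R ->
  exists mu, forall e : R, (0 < e)%R ->
    exists n0, forall n, (n0 <= n)%N -> forall i, l1dist (powerR P n i) mu <= e%:E.
Proof.
move=> d0 dP.
have d1 : (d <= 1)%R by apply: le_trans (dP h) _; exact: powerR_le1.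
have q0 m : (0 <= 2 * (1 - d) ^+ m)%R by rewrite mulr_ge0// exprn_ge0// subr_ge0.
have geom m : exists nu, (forall j, 0 <= nu j)%R /\
    forall i, l1dist (powerR P (m * N) i) nu <= (2 * (1 - d) ^+ m)%:E.
  elim: m => [|m [nu [nu0 nuB]]].
    exists (powerR P 0 h); split=> [|i]; first exact: powerR_ge0.
    by rewrite expr0 mulr1; apply: l1dist_prob_le2; exact: powerR_stochastic.
  exists (fun j => d * powerR P (m * N) h j + (1 - d) * nu j)%R; split=> [j|i].
    by rewrite addr_ge0// mulr_ge0 ?powerR_ge0 ?subr_ge0// ltW.
  by rewrite exprS mulrCA mulSn; exact: minorized_contraction.
have unif (e : R) : (0 < e)%R -> exists n0 nu, forall n, (n0 <= n)%N ->
    forall i, l1dist (powerR P n i) nu <= e%:E.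
  move=> e0.
  have : (fun m => (2 * (1 - d) ^+ m)%R : R) @ \oo --> (0%R : R).
    rewrite -[X in _ --> X](mulr0 2%R).
    by apply: cvgMr; apply: cvg_expr; rewrite ger0_norm ?subr_ge0//; lra.
  move=> /cvgr_le/(_ e e0)[m _ /(_ m (leqnn m)) /= qe].
  have [nu [nu0 nuB]] := geom m; exists (m * N)%N, nu => n mNn i.
  rewrite -(subnK mNn); apply: (@le_trans _ _ (2 * (1 - d) ^+ m)%:E).
    exact: l1dist_powerRD_mix.
  by rewrite lee_fin.
have [mu mu_lim] : exists mu, forall e : R, (0 < e)%R ->
    exists n0, forall n, (n0 <= n)%N -> l1dist (powerR P n h) mu <= e%:E.
  (* From some rank on, all rows of all powers lie in one ball, which makes row [h] a Cauchy
     sequence. *)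
  apply: l1dist_complete => e e0.
  have [n0 [nu nuB]] := unif (e / 2)%R (divr_gt0 e0 (ltr0n _ 2)).
  exists n0 => m n n0m n0n; apply: le_trans (l1dist_triangle nu _ _) _.
  by rewrite (splitr e) EFinD; apply: leeD; [|rewrite l1distC]; exact: nuB.
exists mu => e e0; have e3 : (0 < e / 3)%R by rewrite divr_gt0.
have [n0 [nu nuB]] := unif _ e3; have [n1 muB] := mu_lim _ e3.
exists (maxn n0 n1) => n; rewrite geq_max => /andP[n0n n1n] i.
have -> : e = (e / 3 + e / 3 + e / 3)%R by lra.
rewrite 2!EFinD; apply: le_trans (l1dist_triangle (powerR P n h) _ _) _.
apply: leeD; last exact: muB.
apply: le_trans (l1dist_triangle nu _ _) _.
by apply: leeD; [|rewrite l1distC]; exact: nuB.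
Qed.

(** Stationarity of the limit comes from row [h] of [P^n P = P^(n+1)]: integrating column [j] of [P]
    is l1-continuous because its entries are at most 1. *)
Lemma minorized_strongly_ergodic h N (d : R) : (0 < d)%R ->
  (forall i, d <= powerR P N i h)%R -> strongly_ergodic P.
Proof.
move=> d0 dP; have [mu mu_lim] := minorized_l1_limit d0 dP.
have mu_prob : prob_vector mu.
  apply: prob_vector_l1_limit => e /mu_lim[n0 muB].
  by exists (powerR P n0 h); [exact: powerR_stochastic|exact: muB].
have [mu0 _] := mu_prob.
have P0 i j : (0 <= P i j)%R := (P_stochastic i).1 j.
exists mu; split; first (split=> // j).
  have close (e : R) : (0 < e)%R -> exists n, l1dist (powerR P n h) mu <= e%:E /\
      (`|powerR P n.+1 h j - mu j| <= e)%R.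
    move=> /mu_lim[n0 muB]; exists n0; split; first exact: muB.
    by rewrite -lee_fin; apply: le_trans (l1dist_ge_term _ _ _) (muB _ _ _).
  have P_le1 i : (P i j <= 1)%R by rewrite -(powerR1 P_stochastic) powerR_le1.
  have shrink n : l1dist (fun i => powerR P n h i * P i j)%R (fun i => mu i * P i j)%R
      <= l1dist (powerR P n h) mu.
    apply: le_esum => i _; rewrite lee_fin -mulrBl normrM (ger0_norm (P0 i j)).
    by rewrite -[leRHS]mulr1 ler_wpM2l.
  have step n : \esum_(i in [set: E]) (powerR P n h i * P i j)%:E =
      (powerR P n.+1 h j)%:E.
    rewrite -addn1 -(powerRD P_stochastic); apply: eq_esum => i _.
    by rewrite powerR1.
  (* The sum on the left is not yet known to be finite, hence two one-sided estimates. *)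
  apply/eqP; rewrite eq_le; apply/andP; split; apply/lee_addgt0Pr => e e0.
    have [n [n1 n2]] := close (e / 2)%R (divr_gt0 e0 (ltr0n _ 2)).
    apply: le_trans (@le_esum_l1dist _ _ _ (fun i => powerR P n h i * P i j)%R _) _.
      by move=> i; rewrite mulr_ge0 ?powerR_ge0.
    rewrite step l1distC.
    apply: (@le_trans _ _ ((powerR P n.+1 h j)%:E + (e / 2)%:E)).
      by apply: leeD => //; apply: le_trans (shrink n) n1.
    by rewrite -!EFinD lee_fin; move: n2; rewrite ler_norml => /andP[]; lra.
  have [n [n1 n2]] := close (e / 2)%R (divr_gt0 e0 (ltr0n _ 2)).
  apply: (@le_trans _ _ ((powerR P n.+1 h j)%:E + (e / 2)%:E)).
    by rewrite -!EFinD lee_fin; move: n2; rewrite ler_norml => /andP[]; lra.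
  rewrite -step [in leRHS](splitr e) EFinD addeA; apply: leeD => //.
  apply: le_trans (@le_esum_l1dist _ _ _ (fun i => mu i * P i j)%R _) _.
    by move=> i; rewrite mulr_ge0.
  by apply: leeD => //; apply: le_trans (shrink n) n1.
set S := fun n => _.
have S0 n : 0 <= S n.
  apply: (@le_trans _ _ (l1dist (powerR P n h) mu)); first exact: l1dist_ge0.
  apply: ereal_sup_ubound; exists h => //; apply: eq_esum => j _.
  by rewrite powerE.
have S_le (e : R) n : (forall i, l1dist (powerR P n i) mu <= e%:E) -> S n <= e%:E.
  move=> nB; apply: ge_ereal_sup => _ [i _ <-]; apply: le_trans (nB i).
  by apply: le_esum => j _; rewrite powerE.
have S_fin (e : R) n : S n <= e%:E -> S n \is a fin_num.
  move=> Se; rewrite fin_numElt (lt_le_trans (ltNyr 0) (S0 n))/=.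
  by rewrite (le_lt_trans Se) ?ltry.
apply/fine_cvgP; split.
  have [n0 muB] := mu_lim 1%R ltr01; exists n0 => // n /= n0n.
  by apply: (S_fin 1%R); apply: S_le; exact: muB.
apply/cvgrPdist_le => e /mu_lim[n0 muB]; exists n0 => // n /= n0n.
have Se : S n <= e%:E by apply: S_le; exact: muB.
rewrite sub0r normrN ger0_norm ?fine_ge0//.
by rewrite -lee_fin fineK// (S_fin e).
Qed.

End doeblin.

(** * Hitting times of a finite set and Doeblin's condition *)

Lemma seq_positive_lower_bound (R : realType) (T : eqType) (s : seq T) (f : T -> R) :
  (forall x, x \in s -> 0 < f x)%R ->
  exists2 e : R, (0 < e)%R & forall x, x \in s -> (e <= f x)%R.
Proof.
elim: s => [|x s ih] fs; first by exists 1%R.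
have [y ys|e e0 es] := ih; first by apply: fs; rewrite inE ys orbT.
exists (Num.min e (f x)); first by rewrite lt_min e0 fs ?mem_head.
move=> y; rewrite inE => /predU1P[->|/es ey]; rewrite ge_min ?lexx ?orbT//.
by rewrite ey.
Qed.

Section hitting.
Context {R : realType} {E : countType} (P : E -> E -> R) (H : set E).
Hypothesis P_stochastic : stochastic P.

Let P_ge0 i j : (0 <= P i j)%R.
Proof. exact: (P_stochastic i).1. Qed.

(* For [i] off [H], [survival n i] is the probability that the chain started at
   [i] avoids [H] up to time [n], and [truncated_mean n i] is the expectation of
   [min (sigma_H, n)]; both vanish on [H]. *)
Fixpoint survival n i : R :=
  if i \in H then 0%R else
  if n is m.+1 then fine (\esum_(j in [set: E]) (P i j * survival m j)%:E) else 1%R.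

Definition truncated_mean n i : R := (\sum_(0 <= k < n) survival k i)%R.

Lemma survival_in n i : i \in H -> survival n i = 0%R.
Proof. by case: n => [|n] /= ->. Qed.

Lemma survival_itv n i : (0 <= survival n i <= 1)%R.
Proof.
elim: n i => [|n ih] i /=; case: ifP => _; rewrite ?lexx ?ler01//.
have S0 : 0 <= \esum_(j in [set: E]) (P i j * survival n j)%:E.
  apply: esum_ge0 => j _; rewrite lee_fin mulr_ge0//.
  by have /andP[] := ih j.
have S1 : \esum_(j in [set: E]) (P i j * survival n j)%:E <= 1.
  rewrite -(P_stochastic i).2; apply: le_esum => j _; rewrite lee_fin.
  by rewrite -[leRHS]mulr1 ler_wpM2l//; have /andP[] := ih j.
rewrite fine_ge0//= -lee_fin fineK// fin_numElt (lt_le_trans (ltNyr 0) S0)/=.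
by rewrite (le_lt_trans S1) ?ltry.
Qed.

Lemma survival_ge0 n i : (0 <= survival n i)%R.
Proof. by have /andP[] := survival_itv n i. Qed.

Lemma survival_le1 n i : (survival n i <= 1)%R.
Proof. by have /andP[] := survival_itv n i. Qed.

Lemma survivalS n i : i \notin H ->
  \esum_(j in [set: E]) (P i j * survival n j)%:E = (survival n.+1 i)%:E.
Proof.
move=> iH; rewrite /= ifN// fineK//.
have S0 : 0 <= \esum_(j in [set: E]) (P i j * survival n j)%:E.
  by apply: esum_ge0 => j _; rewrite lee_fin mulr_ge0// survival_ge0.
rewrite fin_numElt (lt_le_trans (ltNyr 0) S0)/= (@le_lt_trans _ _ 1) ?ltry//.
rewrite -(P_stochastic i).2; apply: le_esum => j _; rewrite lee_fin.
by rewrite -[leRHS]mulr1 ler_wpM2l// survival_le1.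
Qed.

Lemma survival_nonincreasing m n i : (m <= n)%N -> (survival n i <= survival m i)%R.
Proof.
suff step k j : (survival k.+1 j <= survival k j)%R.
  elim: n => [|n ih]; first by rewrite leqn0 => /eqP ->.
  by rewrite leq_eqVlt => /predU1P[->//|/ih]; exact: le_trans.
have [jH|jH] := boolP (j \in H); first by rewrite !survival_in.
elim: k j jH => [|k ih] j jH.
  have -> : survival 0 j = 1%R by rewrite /= ifN.
  exact: survival_le1.
rewrite -lee_fin -!survivalS//; apply: le_esum => l _.
rewrite lee_fin ler_wpM2l//.
by have [lH|/ih//] := boolP (l \in H); rewrite !survival_in.
Qed.

Lemma truncated_mean_ge0 n i : (0 <= truncated_mean n i)%R.
Proof. by apply: sumr_ge0 => k _; exact: survival_ge0. Qed.

(** First-step analysis: the term [survival 0 i = 1] counts the first step, and [survivalS] shifts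
    the others. *)
Lemma truncated_meanS n i : i \notin H ->
  \esum_(j in [set: E]) (P i j * truncated_mean n j)%:E + 1 =
  (truncated_mean n.+1 i)%:E.
Proof.
move=> iH; have surv0 : survival 0 i = 1%R by rewrite /= ifN.
rewrite /truncated_mean big_nat_recl// surv0 (addrC 1%R) EFinD; congr (_ + _).
under eq_esum do rewrite mulr_sumr -sumEFin.
rewrite esum_sum; last first.
  by move=> j k _ _; rewrite lee_fin mulr_ge0// survival_ge0.
by rewrite -sumEFin; apply: eq_bigr => k _; rewrite survivalS.
Qed.

(** Off [H], the truncated mean at [n] is at most that at [n + 1], which first-step analysis
    expresses through the one at [n]. *)
Lemma truncated_mean_subsolution n : subsolution P H (truncated_mean n).
Proof.
move=> i iH; have iH' : i \notin H by rewrite notin_setE.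
rewrite /signed_sum (_ : esum _ (fun j => (Num.max (- _) 0)%:E) = 0); last first.
  apply: esum1 => j _; congr EFin; apply/max_idPr.
  by rewrite oppr_le0 mulr_ge0// truncated_mean_ge0.
rewrite sube0 (_ : esum _ _ = \esum_(j in [set: E]) (P i j * truncated_mean n j)%:E).
  rewrite truncated_meanS// lee_fin /truncated_mean big_nat_recr//= lerDl.
  exact: survival_ge0.
rewrite esum_mkcond; apply: eq_esum => j _; rewrite in_setC.
have [jH|jH] /= := boolP (j \in H).
  rewrite /truncated_mean big1_seq ?mulr0// => k _; exact: survival_in.
by congr EFin; apply/max_idPl; rewrite mulr_ge0// truncated_mean_ge0.
Qed.

Lemma truncated_mean_le n i : (truncated_mean n i <= n%:R)%R.
Proof.
have -> : n%:R = (\sum_(0 <= k < n) 1 : R)%R by rewrite big_const_nat subn0 iter_addr_0.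
by apply: ler_sum => k _; exact: survival_le1.
Qed.

(** Markov's inequality: each of the [n] terms of the truncated mean is at least [survival n i]. *)
Lemma survival_le_truncated_mean n i :
  (n%:R * survival n i <= truncated_mean n i)%R.
Proof.
have -> : (n%:R * survival n i = \sum_(0 <= k < n) survival n i)%R.
  by rewrite big_const_nat subn0 iter_addr_0 mulr_natl.
by apply: ler_sum_nat => k /andP[_ kn]; apply: survival_nonincreasing; exact: ltnW.
Qed.

(** The possible return times to [h] form an additive set of gcd 1, hence contain all large
    integers. From [i] the chain reaches [h] in [a i] steps and then returns at leisure; finiteness
    of [H] bounds [a] on it. *)
Lemma eventually_positive h : irreducible P -> aperiodic P -> finite_set H ->
  exists N, forall i n, H i -> (N <= n)%N -> (0 < powerR P n i h)%R.
Proof.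
move=> P_irr P_aper /finite_seqP[s ->].
have [N hN] : exists N, forall n, (N <= n)%N -> (0 < powerR P n h h)%R.
  apply: (@additive_gcd1_cofinite [set n | (0 < powerR P n h h)%R]) => /=.
  - by rewrite powerR0 eqxx.
  - by move=> m n; exact: powerR_gt0D.
  - move=> d d_dvd; apply: (P_aper h) => n _ pn; apply: d_dvd.
    by rewrite -lte_fin -powerE.
have /choice[a pa] : forall i, exists n, (0 < powerR P n i h)%R.
  by move=> i; have [n] := P_irr i h; rewrite powerE// lte_fin; exists n.
exists (\max_(i <- s) a i + N)%N => i n /= si.
have ai : (a i <= \max_(i <- s) a i)%N by exact: leq_bigmax_seq.
move=> Nn; have an : (a i <= n)%N := leq_trans (leq_trans ai (leq_addr _ _)) Nn.
rewrite -(subnKC an); apply: powerR_gt0D => //; apply: hN.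
by rewrite leq_subRL// (leq_trans _ Nn)// leq_add2r.
Qed.

(** Within [K] steps [H] is hit with probability at least 1/2 from anywhere, and from [H] the state
    [h] is reached with probability at least [e] in the time that remains. *)
Lemma bounded_truncated_mean_minorized h (M : R) :
  irreducible P -> aperiodic P -> finite_set H ->
  (forall n i, truncated_mean n i <= M)%R ->
  exists N (d : R), (0 < d)%R /\ forall i, (d <= powerR P N i h)%R.
Proof.
move=> P_irr P_aper H_fin V_le.
have [N0 posN0] := eventually_positive h P_irr P_aper H_fin.
have M0 : (0 <= M)%R by apply: le_trans (V_le 0%N h); rewrite /truncated_mean big_geq.
have [K K0 K_half] : exists2 K, (0 < K)%N & forall i, (survival K i <= 1 / 2)%R.
  have [K MK] : exists K, (2 * M < K%:R)%R.
    by exists (Num.bound (2 * M)); apply: archi_boundP; rewrite mulr_ge0.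
  have K0 : (0 < K%:R :> R)%R by apply: le_lt_trans MK; rewrite mulr_ge0.
  exists K; first by rewrite -(ltr0n R).
  move=> i; have VM := V_le K i; have KV := survival_le_truncated_mean K i.
  rewrite -(ler_pM2l K0); lra.
(* The total time is fixed, so the time left after entering [H] varies; [e] is a lower bound over
   the finitely many pairs of an entrance state and an [m <= K]. *)
have [e e0 eP] : exists2 e : R, (0 < e)%R &
    forall i m, H i -> (m <= K)%N -> (e <= powerR P (N0 + m) i h)%R.
  have /finite_seqP[s Hs] := H_fin.
  have [|e e0 es] := @seq_positive_lower_bound R _
    [seq (i, m) | i <- s, m <- iota 0 K.+1] (fun x => powerR P (N0 + x.2) x.1 h).
    move=> x /allpairsP[[i m] [/= si _ ->]] /=; apply: posN0; rewrite ?leq_addr//.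
    by rewrite Hs.
  exists e => // i m; rewrite Hs => /= si mK; apply: (es (i, m)).
  by apply/allpairsP; exists (i, m); rewrite mem_iota add0n ltnS.
(* The factor [1 - survival k i] is the probability of hitting [H] by time [k]; it is 1 on [H],
   where the claim reduces to [eP]. *)
have lower k i : (k <= K)%N -> (e * (1 - survival k i) <= powerR P (N0 + k) i h)%R.
  elim: k i => [|k ih] i kK; have [iH|iH] := boolP (i \in H).
  - by rewrite survival_in// subr0 mulr1 eP//; rewrite -in_setE.
  - by rewrite /= ifN// subrr mulr0 powerR_ge0.
  - by rewrite survival_in// subr0 mulr1 eP//; rewrite -in_setE.
  rewrite mulrBr mulr1 lerBlDr -lee_fin EFinD addnS -powerRS// EFinM -survivalS//.
  rewrite -ge0_esumZl ?(ltW e0)//; last first.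
    by move=> j _; rewrite lee_fin mulr_ge0// survival_ge0.
  rewrite -esumD; last 2 first.
  - by move=> j _; rewrite lee_fin mulr_ge0// powerR_ge0.
  - by move=> j _; rewrite -EFinM lee_fin !mulr_ge0 ?survival_ge0// ltW.
  apply: (@le_trans _ _ (\esum_(j in [set: E]) ((P i j)%:E * e%:E))).
    rewrite ge0_esumZr ?(ltW e0)// ?(P_stochastic i).2 ?mul1e// => j _.
    by rewrite lee_fin.
  apply: le_esum => j _; rewrite -!EFinM -EFinD lee_fin.
  have := ler_wpM2l (P_ge0 i j) (ih j (ltnW kK)); lra.
exists (N0 + K)%N, (e / 2)%R; split=> [|i]; first by rewrite divr_gt0.
apply: le_trans (lower K i (leqnn K)).
by rewrite ler_wpM2l ?(ltW e0)//; have := K_half i; lra.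
Qed.

End hitting.

(** * Infinite supremum versus infinite upper limit *)

(** Finitely many terms below [+oo] have a real upper bound, so an infinite supremum is attained by
    every tail; conversely, the tail from rank 1 is the supremum in question. *)
Lemma ereal_sup_pinfty_limn_esup (R : realType) (u : nat -> \bar R) :
  (forall n, (1 <= n)%N -> u n < +oo) ->
  ereal_sup [set u n | n in [set n | (1 <= n)%N]] = +oo <-> limn_esup u = +oo.
Proof.
move=> u_fin; rewrite limn_esup_lim.
have -> : limn (esups u) = ereal_inf (range (esups u)).
  by apply/cvg_lim => //; exact: cvg_esups_inf.
split=> [sup_oo|inf_oo]; last first.
  apply/eqP; rewrite -leye_eq -inf_oo.
  by apply: ereal_inf_lbound; exists 1%N.
apply/eqP; rewrite -leye_eq; apply: le_ereal_inf_tmp => _ [N _ <-].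
rewrite leye_eq; apply/eqP/eq_infty => M.
(* The range starts at 1 since [u 0] may be [+oo]. *)
have [B B_ub] : exists B : R, forall n, (1 <= n < N)%N -> u n <= B%:E.
  elim: N => [|N [B B_ub]]; first by exists 0%R => n; rewrite ltn0 andbF.
  have [C uC] : exists C : R, (1 <= N)%N -> u N <= C%:E.
    case: (posnP N) => [->|N0]; first by exists 0%R.
    case: (u N) (u_fin N N0) => [r| |]// _; last by exists 0%R; rewrite leNye.
    by exists r.
  exists (Num.max B C) => n; rewrite ltnS EFin_max le_max => /andP[n1].
  rewrite leq_eqVlt => /predU1P[nN|nN]; last by rewrite B_ub// n1.
  by rewrite nN in n1 *; rewrite uC// orbT.
have : (Num.max M B)%:E < ereal_sup [set u n | n in [set n | (1 <= n)%N]].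
  by rewrite sup_oo ltry.
move=> /ereal_sup_gt[_ [n /= n1 <-]]; rewrite EFin_max gt_max => /andP[Mn Bn].
apply: le_trans (ltW Mn) _; apply: ereal_sup_ubound; exists n => //=.
by rewrite leqNgt; apply/negP => nN; have := B_ub n; rewrite n1 nN leNgt Bn => /(_ isT).
Qed.

(** * The criterion, with both forms of condition (2) *)

Theorem mainTheorem6 (R : realType) (E : countType) (P : E -> E -> R)
    (H : set E) (P_stochastic : stochastic P) (P_irreducible : irreducible P)
    (P_aperiodic : aperiodic P) (H_finite : finite_set H)
    (H_nonempty : H !=set0) :
  (~ strongly_ergodic P <->
   exists y : nat -> E -> R,
     bounded_above_subsolutions P H y /\
     ereal_sup [set sup_off H (y n) | n in [set n | (1 <= n)%N]] = +oo) /\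
  (forall y : nat -> E -> R, bounded_above_subsolutions P H y ->
     (ereal_sup [set sup_off H (y n) | n in [set n | (1 <= n)%N]] = +oo <->
      limn_esup (fun n => sup_off H (y n)) = +oo)).
Proof.
split; last first.
  move=> y y_sub; apply: ereal_sup_pinfty_limn_esup => n n1.
  exact: (y_sub n n1).1.
have [h Hh] := H_nonempty.
split=> [not_erg|[y [y_sub sup_oo]] P_erg].
  have V_sub : bounded_above_subsolutions P H (truncated_mean P H).
    move=> n _; split; last exact: truncated_mean_subsolution.
    apply: (@le_lt_trans _ _ n%:R%:E); last by rewrite ltry.
    by apply: ge_ereal_sup => _ [i _ <-]; rewrite lee_fin truncated_mean_le.
  exists (truncated_mean P H); split => //; apply/eqP/negPn/negP => sup_fin.
  apply: not_erg.
  (* Taking [M] nonnegative makes it bound the truncated means also on [H] and at [n = 0], which the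
     supremum does not cover. *)
  have [M [M0 V_le]] : exists M : R, (0 <= M)%R /\
      ereal_sup [set sup_off H (truncated_mean P H n) | n in [set n | (1 <= n)%N]]
        <= M%:E.
    case: (ereal_sup _) sup_fin => [r| |]// _; last by exists 0%R; rewrite leNye.
    by exists (Num.max r 0%R); rewrite lee_fin !le_max !lexx orbT.
  have [n i|N [d [d0 dP]]] :=
      @bounded_truncated_mean_minorized _ _ P H P_stochastic h M
        P_irreducible P_aperiodic H_finite.
    have [iH|iH] := boolP (i \in H).
      by rewrite /truncated_mean big1_seq// => k _; exact: survival_in.
    case: n => [|n]; first by rewrite /truncated_mean big_geq.
    rewrite -lee_fin; apply: le_trans V_le.
    apply: (@le_trans _ _ (sup_off H (truncated_mean P H n.+1))).
      by apply: ereal_sup_ubound; exists i => //; move: iH; rewrite notin_setE.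
    by apply: ereal_sup_ubound; exists n.+1.
  exact: minorized_strongly_ergodic d0 dP.
have [N [d [d0 dP]]] := strongly_ergodic_minorized P_stochastic h P_erg P_irreducible.
(* The bound [N / d] depends on the chain and [h] only, so it serves all [y n] at once. *)
suff : ereal_sup [set sup_off H (y n) | n in [set n | (1 <= n)%N]] <= (N%:R / d)%:E.
  by rewrite sup_oo leye_eq.
apply: ge_ereal_sup => _ [n /= n1 <-]; have [y_fin y_n] := y_sub n n1.
exact: (subsolution_bound P_stochastic Hh).
Qed.
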